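(* For every integer $r\geq 2$ there exists $\eta_0>0$ such that for every $0<\eta\leq\eta_0$ there exists $n_0$ such that for every $n\geq n_0$ the following holds. If $G$ is a standard multigraph on $n$ vertices with $\delta(G)\geq 2(1-1/r+\eta)n$, then $G$ contains a $\bar{\mathcal K}_r$-tiling covering all but at most $\eta n$ vertices.
   Context: A standard multigraph is a loopless multigraph in which any two distinct vertices are joined by $\mu\in\{0,1,2\}$ edges (light if $1$, heavy if $2$); degrees count edges with multiplicity and $\delta(G)$ is the minimum degree. $\bar{\mathcal K}_r$ is the family of standard multigraphs on $r$ vertices in which every pair is heavy except the pairs of some matching, which are light. A $\bar{\mathcal K}_r$-tiling in $G$ is a collection of vertex-disjoint submultigraphs of $G$ each isomorphic to an element of $\bar{\mathcal K}_r$ (a submultigraph on vertex set $S$ isomorphic to $U$ exists iff there is a bijection $\phi:V(U)\to S$ with $\mu_G(\phi(x)\phi(y))\geq\mu_U(xy)$). *)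

(* Defs.v *)
From mathcomp Require Import all_boot.
Set Implicit Arguments.
Unset Strict Implicit.
Unset Printing Implicit Defensive.

Record std_multigraph (V : finType) := StdMultigraph {
  mu :> V -> V -> nat;
  mu_sym : forall x y, mu x y = mu y x;
  mu_loopless : forall x, mu x x = 0;
  mu_le2 : forall x y, mu x y <= 2 }.

Definition degree (V : finType) (G : std_multigraph V) (x : V) : nat :=
  \sum_(y : V) G x y.

(* Every degree is at most [2 * #|V|], so the default value of the iterated
   minimum is immaterial when V is nonempty; the value is 0 when V is empty. *)
Definition min_degree (V : finType) (G : std_multigraph V) : nat :=
  \big[minn/2 * #|V|]_(x : V) degree G x.

Definition is_matching (U : finType) (M : {set {set U}}) : Prop :=
  {in M, forall e : {set U}, #|e| = 2} /\ trivIset M.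

(* Membership in the family, up to the naming of the r vertices. *)
Definition Kbar (r : nat) (H : std_multigraph 'I_r) : Prop :=
  exists2 M : {set {set 'I_r}}, is_matching M &
    forall x y, x != y -> H x y = if [set x; y] \in M then 1 else 2.

(* A submultigraph has its own vertex set; its multiplicities are extended
   by 0 to pairs of vertices of the host that are not both in that set. *)
Record submultigraph (V : finType) (G : std_multigraph V) := Submultigraph {
  vset : {set V};
  smu : V -> V -> nat;
  smu_sym : forall x y, smu x y = smu y x;
  smu_le : forall x y, smu x y <= G x y;
  smu_out : forall x y, x \notin vset -> smu x y = 0 }.

Definition sub_iso (V U : finType) (G : std_multigraph V)
    (F : submultigraph G) (H : std_multigraph U) : Prop :=
  exists phi : U -> V,
    [/\ injective phi, phi @: [set: U] = vset F &
        forall x y, smu F (phi x) (phi y) = H x y].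

Definition Kbar_tiling (r : nat) (V : finType) (G : std_multigraph V) (k : nat)
    (T : 'I_k -> submultigraph G) : Prop :=
  (forall i j, i != j -> [disjoint vset (T i) & vset (T j)]) /\
  (forall i, exists2 H : std_multigraph 'I_r, Kbar H & sub_iso (T i) H).

Definition covered (V : finType) (G : std_multigraph V) (k : nat)
    (T : 'I_k -> submultigraph G) : {set V} :=
  \bigcup_(i < k) vset (T i).

(* Main.v *)
(* Remove r-tiles greedily while every remaining vertex has total deficit (2 minus
   the multiplicity, summed over the remaining vertices, itself included) at most
   2/r times the number of remaining vertices. Under this hypothesis, for every
   cost function some r-tile costs at most r times the average cost, up to an
   additive constant. Taking as costs minus the deficits to vertices weighted by
   the cubes of their excesses, the removed tile makes the sum of fourth powers
   of the excesses grow so slowly that no excess exceeds O(n^(3/4)), which the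
   slack in the degree hypothesis absorbs until few vertices remain. *)
Require Import Defs.
From mathcomp Require Import all_boot all_order all_algebra.
From mathcomp Require Import reals ring lra zify.
Set Implicit Arguments.
Unset Strict Implicit.
Unset Printing Implicit Defensive.
Import Order.TTheory GRing.Theory Num.Theory.
Local Open Scope ring_scope.

(** * Deficits and tiles *)

Definition deficit (V : finType) (G : std_multigraph V) (x y : V) : nat :=
  (2 - G x y)%N.

Definition set_deficit (V : finType) (G : std_multigraph V) (I : {set V}) (x : V) : nat :=
  (\sum_(y in I) deficit G x y)%N.

(* Since [deficit G x x = 2], the bound 3 says that [x] has at most one light
   edge and no missing edge to the rest of [I]. *)
Definition tile (V : finType) (G : std_multigraph V) (I : {set V}) : bool :=
  [forall x in I, (set_deficit G I x <= 3)%N].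

Lemma deficitC (V : finType) (G : std_multigraph V) x y :
  deficit G x y = deficit G y x.
Proof. by rewrite /deficit mu_sym. Qed.

Lemma deficitxx (V : finType) (G : std_multigraph V) x : deficit G x x = 2.
Proof. by rewrite /deficit mu_loopless. Qed.

Lemma deficit_le2 (V : finType) (G : std_multigraph V) x y : (deficit G x y <= 2)%N.
Proof. exact: leq_subr. Qed.

Lemma set_deficit_sub (V : finType) (G : std_multigraph V) (I J : {set V}) x :
  I \subset J -> (set_deficit G I x <= set_deficit G J x)%N.
Proof.
move=> sIJ; rewrite /set_deficit [leqRHS](big_setID I) /= (setIidPr sIJ); exact: leq_addr.
Qed.

Lemma set_deficit_le (V : finType) (G : std_multigraph V) (I : {set V}) x :
  (set_deficit G I x <= 2 * #|I|)%N.
Proof.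
rewrite mulnC -sum_nat_const; apply: leq_sum => y _; exact: deficit_le2.
Qed.

Lemma deficit_le_set (V : finType) (G : std_multigraph V) (I : {set V}) x y :
  y \in I -> (deficit G x y <= set_deficit G I x)%N.
Proof. by move=> yI; rewrite /set_deficit (big_setD1 y) //= leq_addr. Qed.

Lemma set_deficitU1 (V : finType) (G : std_multigraph V) (I : {set V}) j x :
  j \notin I -> set_deficit G (j |: I) x = (deficit G x j + set_deficit G I x)%N.
Proof. by move=> jI; rewrite /set_deficit big_setU1. Qed.

Lemma set_deficitD1 (V : finType) (G : std_multigraph V) (I : {set V}) j x :
  j \in I -> set_deficit G I x = (deficit G x j + set_deficit G (I :\ j) x)%N.
Proof. by move=> jI; rewrite /set_deficit (big_setD1 j). Qed.

Lemma set_deficitD (V : finType) (G : std_multigraph V) (I S : {set V}) x :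
  I \subset S -> set_deficit G S x = (set_deficit G I x + set_deficit G (S :\: I) x)%N.
Proof. by move=> sIS; rewrite /set_deficit [LHS](big_setID I) /= (setIidPr sIS). Qed.

Lemma tileP (V : finType) (G : std_multigraph V) (I : {set V}) :
  reflect {in I, forall x, (set_deficit G I x <= 3)%N} (tile G I).
Proof. exact: forall_inP. Qed.

Lemma tile_sub (V : finType) (G : std_multigraph V) (I J : {set V}) :
  I \subset J -> tile G J -> tile G I.
Proof.
move=> sIJ /tileP tJ; apply/tileP=> x xI.
by apply: leq_trans (set_deficit_sub G x sIJ) (tJ _ _); apply: (subsetP sIJ).
Qed.

Lemma tile0 (V : finType) (G : std_multigraph V) : tile G set0.
Proof. by apply/tileP=> x; rewrite inE. Qed.

(** * Tiles of a given size and saturated tiles *)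

Definition has_tile (V : finType) (G : std_multigraph V) (X : {set V}) (s : nat) : bool :=
  [exists I : {set V}, [&& I \subset X, tile G I & #|I| == s]].

Lemma has_tileP (V : finType) (G : std_multigraph V) (X : {set V}) s :
  reflect (exists I : {set V}, [/\ I \subset X, tile G I & #|I| = s]) (has_tile G X s).
Proof.
apply: (iffP existsP) => [[I /and3P[? ? /eqP ?]]|[I [? ? /eqP ?]]]; exists I => //.
exact/and3P.
Qed.

Lemma has_tile0 (V : finType) (G : std_multigraph V) (X : {set V}) : has_tile G X 0.
Proof. by apply/has_tileP; exists set0; rewrite sub0set tile0 cards0. Qed.

Lemma has_tile_sub (V : finType) (G : std_multigraph V) (X Y : {set V}) s :
  X \subset Y -> has_tile G X s -> has_tile G Y s.
Proof.
move=> sXY /has_tileP[I [sIX tI cI]]; apply/has_tileP; exists I; split=> //.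
exact: subset_trans sXY.
Qed.

(** It suffices to delete [u] from the tile, or any vertex if [u] is absent. This is what allows
    giving mass to a new vertex when the support has no [r]-tile. *)
Lemma has_tileU1 (V : finType) (G : std_multigraph V) (X : {set V}) u s :
  has_tile G (u |: X) s.+1 -> has_tile G X s.
Proof.
move=> /has_tileP[I [sIX tI cI]].
have [v vI sIvX] : exists2 v, v \in I & I :\ v \subset X.
  have [uI|uNI] := boolP (u \in I); first by exists u; rewrite ?subD1set // subDset.
  have /card_gt0P[v vI] : (0 < #|I|)%N by rewrite cI.
  exists v => //; apply/subsetP=> y /setD1P[_ yI].
  case/setU1P: (subsetP sIX y yI) => // yu.
  by rewrite -yu yI in uNI.
apply/has_tileP; exists (I :\ v); split=> //.
  by apply: tile_sub tI; exact: subD1set.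
by move: cI; rewrite (cardsD1 v) vI => -[].
Qed.

(* A largest tile of [X] with the fewest light edges: a vertex of deficit at
   most one to it could be added, or exchanged for an end of a light edge. *)
Lemma saturated_tile (V : finType) (G : std_multigraph V) (X : {set V}) s :
  has_tile G X s -> ~~ has_tile G X s.+1 ->
  exists I : {set V}, [/\ I \subset X, tile G I, #|I| = s &
    {in X, forall j, (2 <= set_deficit G I j)%N}].
Proof.
move=> /existsP[I0 PI0] noS.
pose P (I : {set V}) := [&& I \subset X, tile G I & #|I| == s].
(* On a tile, [total] is twice the number of vertices plus twice the number of light edges. *)
pose total (I : {set V}) := (\sum_(x in I) set_deficit G I x)%N.
case: (@arg_minnP _ I0 P total PI0) => I /and3P[sIX /tileP tI /eqP cI] minI.
exists I; split=> //; first exact/tileP.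
move=> j jX; rewrite leqNgt; apply/negP=> lt2.
have jI : j \notin I.
  by apply: contraL lt2 => /(deficit_le_set G j); rewrite deficitxx -leqNgt.
have [add|/forall_inPn[a aI]] := boolP [forall a in I, (deficit G a j + set_deficit G I a <= 3)%N].
  case/negP: noS; apply/has_tileP; exists (j |: I); split.
  - by rewrite subUset sub1set jX.
  - apply/tileP=> x /setU1P[->|xI]; rewrite set_deficitU1 ?deficitxx //.
    exact: (forall_inP add).
  - by rewrite cardsU1 jI cI.
rewrite -ltnNge => gt3.
(* The obstruction [a] to adding [j] must be joined to [j] by a light edge and already lie on a
   light edge of [I]; the bound on [j] leaves it no other deficit to [I]. *)
have da : deficit G j a = 1.
  have := deficit_le_set G j aI; have := tI a aI; move: gt3; rewrite deficitC; lia.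
have dIa : set_deficit G I a = 3 by have := tI a aI; move: gt3; rewrite deficitC da; lia.
have dja : set_deficit G (I :\ a) j = 0.
  by move: lt2; rewrite (set_deficitD1 G j aI) da; lia.
have dj x : x \in I :\ a -> deficit G x j = 0.
  by move=> /(deficit_le_set G j); rewrite dja deficitC; lia.
have jIa : j \notin I :\ a by rewrite !inE negb_and jI orbT.
(* Exchanging [a] for [j] loses the light edge at [a] and creates none, so [total] drops by 2,
   against minimality. *)
have := minI (j |: I :\ a); rewrite /P /total big_setU1 //= (big_setD1 a aI) /=.
have -> : (\sum_(x in I :\ a) set_deficit G (j |: I :\ a) x =
           \sum_(x in I :\ a) set_deficit G (I :\ a) x)%N.
  by apply: eq_bigr => x xIa; rewrite set_deficitU1 // dj.
have -> : (\sum_(x in I :\ a) set_deficit G I x =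
  \sum_(x in I :\ a) set_deficit G (I :\ a) x + set_deficit G (I :\ a) a)%N.
  rewrite -big_split /=; apply: eq_bigr => x _.
  by rewrite (set_deficitD1 G x aI) deficitC addnC.
rewrite set_deficitU1 // deficitxx dja dIa => H.
suff /H : [&& (j |: I :\ a) \subset X, tile G (j |: I :\ a) & #|j |: I :\ a| == s].
  by move=> {}H; move: (set_deficitD1 G a aI) H; rewrite dIa deficitxx; clear; lia.
apply/and3P; split.
- by rewrite subUset sub1set jX; apply: subset_trans (subD1set _ _) sIX.
- apply/tileP=> x /setU1P[->|xIa]; rewrite set_deficitU1 //.
    by rewrite deficitxx dja.
  rewrite dj //; apply: leq_trans (set_deficit_sub G x (subD1set I a)) (tI _ _).
  by case/setD1P: xIa.
- by rewrite cardsU1 jIa -cI [in X in _ == X](cardsD1 a) aI.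
Qed.

(** * Energy of mass distributions and its maximizers *)

(** A Motzkin-Straus quadratic form with linear gain [z]. The diagonal deficit 2 penalizes
    concentrating mass on a single vertex. *)
Definition energy (R : realFieldType) (V : finType) (G : std_multigraph V)
    (z q : V -> R) : R :=
  4 * (\sum_u z u * q u) - \sum_u \sum_w (deficit G u w)%:R * q u * q w.

(** The energy is quadratic, so its second-order expansion is exact; the last term comes from
    [deficit G u u = 2]. *)
Lemma energy_step (R : realFieldType) (V : finType) (G : std_multigraph V)
    (z q : V -> R) (u : V) (t : R) :
  energy G z (fun x => q x + t * (x == u)%:R) =
  energy G z q + 2 * t * (2 * z u - \sum_w (deficit G u w)%:R * q w) - 2 * t ^+ 2.
Proof.
have sum1 (f : V -> R) : \sum_x f x * (x == u)%:R = f u.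
  rewrite (bigD1 u) //= eqxx mulr1 big1 ?addr0 // => x /negPf ->.
  by rewrite mulr0.
pose d x w : R := (deficit G x w)%:R.
have e1 : \sum_x z x * (q x + t * (x == u)%:R) = \sum_x z x * q x + t * z u.
  rewrite -(sum1 (fun x => t * z x)) -big_split /=; apply: eq_bigr => x _; ring.
have e2 x : \sum_w d x w * (q x + t * (x == u)%:R) * (q w + t * (w == u)%:R) =
    \sum_w d x w * q x * q w + t * d x u * q x
    + (t * \sum_w d x w * q w + t ^+ 2 * d x u) * (x == u)%:R.
  rewrite -(sum1 (fun w => t * d x w * q x)) -(sum1 (fun w => t ^+ 2 * d x w)).
  rewrite mulr_sumr -!big_split /= mulr_suml -big_split /=.
  by apply: eq_bigr => w _; ring.
rewrite /energy e1 (eq_bigr _ (fun x _ => e2 x)) big_split /= sum1 big_split /=.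
have -> : \sum_x t * d x u * q x = t * \sum_w d u w * q w.
  by rewrite mulr_sumr; apply: eq_bigr => x _; rewrite /d deficitC mulrA.
rewrite /d deficitxx; ring.
Qed.

(** Masses are integers from 0 to [K]: the distributions form a finite type, so maximizers exist
    without compactness, and the optimality conditions hold up to an error of 1. *)
Definition supp (V : finType) (K : nat) (q : {ffun V -> 'I_K.+1}) : {set V} :=
  [set u | (0 < q u)%N].

Definition admissible (V : finType) (G : std_multigraph V) (S : {set V}) (r K : nat)
    (q : {ffun V -> 'I_K.+1}) : bool :=
  (supp q \subset S) && ~~ has_tile G (supp q) r.+1.

Definition optimal (R : realFieldType) (V : finType) (G : std_multigraph V)
    (S : {set V}) (r K : nat) (z : V -> R) (q : {ffun V -> 'I_K.+1}) : Prop :=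
  admissible G S r q /\
  forall q' : {ffun V -> 'I_K.+1}, admissible G S r q' ->
    energy G z (fun u => (q' u)%:R) <= energy G z (fun u => (q u)%:R).

(** Half the partial derivative of [energy] at [u]. *)
Definition grad (R : realFieldType) (V : finType) (G : std_multigraph V)
    (z q : V -> R) (u : V) : R :=
  2 * z u - \sum_w (deficit G u w)%:R * q w.

Lemma supp0 (V : finType) (K : nat) : supp [ffun _ : V => ord0 : 'I_K.+1] = set0.
Proof. by apply/setP=> u; rewrite !inE ffunE. Qed.

Lemma admissible0 (V : finType) (G : std_multigraph V) (S : {set V}) (r K : nat) :
  admissible G S r [ffun _ => ord0 : 'I_K.+1].
Proof.
rewrite /admissible supp0 sub0set /=; apply/has_tileP=> -[I [sI _ cI]].
by move: sI cI; rewrite subset0 => /eqP->; rewrite cards0.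
Qed.

Lemma optimal_exists (R : realFieldType) (V : finType) (G : std_multigraph V)
    (S : {set V}) (r K : nat) (z : V -> R) :
  exists q : {ffun V -> 'I_K.+1}, optimal G S r z q.
Proof.
case: (@arg_maxP _ _ _ _ (@admissible V G S r K)
  (fun q => energy G z (fun u => (q u)%:R)) (admissible0 G S r K)) => q aq mq.
by exists q; split.
Qed.

(** Taking one unit of mass off [i] stays admissible and changes the energy by [-2 * grad - 2],
    which cannot be positive. *)
Lemma optimal_grad_ge (R : realFieldType) (V : finType) (G : std_multigraph V)
    (S : {set V}) (r K : nat) (z : V -> R) (q : {ffun V -> 'I_K.+1}) (i : V) :
  optimal G S r z q -> i \in supp q -> -1 <= grad G z (fun u => (q u)%:R) i.
Proof.
move=> [/andP[sq tq] opt]; rewrite inE => qi.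
pose q' := [ffun x => if x == i then inord (q i).-1 else q x] : {ffun V -> 'I_K.+1}.
have q'E x : (q' x)%:R = (q x)%:R + (-1) * (x == i)%:R :> R.
  rewrite ffunE; case: eqP => [->|_]; last by rewrite mulr0 addr0.
  rewrite inordK; last by have := ltn_ord (q i); lia.
  by rewrite mulr1 -[in RHS](prednK qi) -natr1 addrK.
have sq' : supp q' \subset supp q.
  by apply/subsetP=> x; rewrite !inE ffunE; case: eqP => [->|].
have := opt q'; rewrite /admissible (subset_trans sq' sq) /=.
rewrite (contra (has_tile_sub sq') tq) => /(_ isT).
have -> : energy G z (fun u => (q' u)%:R) =
    energy G z (fun x => (q x)%:R + (-1) * (x == i)%:R).
  rewrite /energy; under eq_bigr do rewrite q'E.
  by under [X in _ - X]eq_bigr do under eq_bigr do rewrite !q'E.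
rewrite energy_step -/(grad _ _ _ _); lra.
Qed.

(** Adding one unit of mass at [i] enlarges the support by at most one vertex, so it creates no tile
    of size [r.+1]; the energy changes by [2 * grad - 2]. *)
Lemma optimal_grad_le (R : realFieldType) (V : finType) (G : std_multigraph V)
    (S : {set V}) (r K : nat) (z : V -> R) (q : {ffun V -> 'I_K.+1}) (i : V) :
  optimal G S r z q -> ~~ has_tile G (supp q) r -> i \in S -> z i <= K%:R ->
  grad G z (fun u => (q u)%:R) i <= 1.
Proof.
move=> [/andP[sq tq] opt] nt iS zK.
have [qiK|] := ltnP (q i) K; last first.
  (* A mass at the cap cannot be raised, but its self-deficit alone costs [2 * K], at least
     [2 * z i], so the gradient is at most 0. *)
  move=> Kq; have Kq' : K%:R <= (q i)%:R :> R by rewrite ler_nat.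
  rewrite /grad (bigD1 i) //= deficitxx.
  have : 0 <= \sum_(w | w != i) (deficit G i w)%:R * (q w)%:R :> R.
    by apply: sumr_ge0 => w _; rewrite mulr_ge0.
  lra.
pose q' := [ffun x => if x == i then inord (q i).+1 else q x] : {ffun V -> 'I_K.+1}.
have q'E x : (q' x)%:R = (q x)%:R + 1 * (x == i)%:R :> R.
  rewrite ffunE; case: eqP => [->|_]; last by rewrite mulr0 addr0.
  by rewrite inordK // mulr1 natr1.
have sq' : supp q' \subset i |: supp q.
  by apply/subsetP=> x; rewrite !inE ffunE; case: eqP => [->|].
have := opt q'; rewrite /admissible (subset_trans sq') ?subUset ?sub1set ?iS //=.
have -> : has_tile G (supp q') r.+1 = false.
  apply: contraNF nt => ht; exact: has_tileU1 (has_tile_sub sq' ht).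
move=> /(_ isT).
have -> : energy G z (fun u => (q' u)%:R) =
    energy G z (fun x => (q x)%:R + 1 * (x == i)%:R).
  rewrite /energy; under eq_bigr do rewrite q'E.
  by under [X in _ - X]eq_bigr do under eq_bigr do rewrite !q'E.
rewrite energy_step -/(grad _ _ _ _); lra.
Qed.

Lemma sum_set_deficit (R : realFieldType) (V : finType) (G : std_multigraph V)
    (I : {set V}) (q : V -> R) :
  \sum_(i in I) \sum_w (deficit G i w)%:R * q w = \sum_w (set_deficit G I w)%:R * q w.
Proof.
rewrite exchange_big /=; apply: eq_bigr => w _.
rewrite -mulr_suml /set_deficit natr_sum; congr (_ * _).
by apply: eq_bigr => i _; rewrite deficitC.
Qed.

(** Sum the lower gradient bounds over [I]: by saturation each unit of mass is charged at least
    2. *)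
Lemma saturated_sum (R : realFieldType) (V : finType) (G : std_multigraph V)
    (S I : {set V}) (r K : nat) (z : V -> R) (q : {ffun V -> 'I_K.+1}) :
  optimal G S r z q -> I \subset supp q ->
  {in supp q, forall j, (2 <= set_deficit G I j)%N} ->
  2 * \sum_u (q u)%:R - #|I|%:R <= 2 * \sum_(i in I) z i.
Proof.
move=> opt sI sat.
have : \sum_(i in I) -1 <= \sum_(i in I) grad G z (fun u => (q u)%:R) i.
  by apply: ler_sum => i iI; apply: optimal_grad_ge opt _; apply: (subsetP sI).
rewrite sumr_const sumrB sum_set_deficit -mulr_sumr.
have : \sum_w 2 * (q w)%:R <= \sum_w (set_deficit G I w)%:R * (q w)%:R :> R.
  apply: ler_sum => w _; have [qw|] := posnP (q w); first by rewrite qw !mulr0.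
  by move=> qw; rewrite ler_wpM2r // ler_nat sat // inE.
rewrite -mulr_sumr -mulNrn; lra.
Qed.

(** Sum the upper gradient bounds over [S]: by the deficit hypothesis each unit of mass is charged
    at most [2 * #|S| / r]. *)
Lemma optimal_mass_ge (R : realFieldType) (V : finType) (G : std_multigraph V)
    (S : {set V}) (r K : nat) (z : V -> R) (q : {ffun V -> 'I_K.+1}) :
  {in S, forall v, (r * set_deficit G S v <= 2 * #|S|)%N} ->
  optimal G S r z q -> ~~ has_tile G (supp q) r -> {in S, forall u, z u <= K%:R} ->
  2 * r%:R * \sum_(u in S) z u - r%:R * #|S|%:R <=
  2 * #|S|%:R * \sum_u (q u)%:R.
Proof.
move=> dS opt nt zK.
have : \sum_(u in S) grad G z (fun u => (q u)%:R) u <= \sum_(u in S) 1.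
  by apply: ler_sum => u uS; apply: optimal_grad_le opt _ _ _ => //; apply: zK.
rewrite sumr_const sumrB sum_set_deficit -mulr_sumr => H.
have : r%:R * \sum_w (set_deficit G S w)%:R * (q w)%:R <=
    2 * #|S|%:R * \sum_w (q w)%:R :> R.
  rewrite !mulr_sumr; apply: ler_sum => w _.
  have [qw|qw] := posnP (q w); first by rewrite qw !mulr0.
  rewrite mulrA ler_wpM2r // -!natrM ler_nat dS //.
  by case: opt => /andP[/subsetP + _] _; apply; rewrite inE.
move: H => /(ler_wpM2l (ler0n R r)); lra.
Qed.

(** * Raising the water level to find a cheap tile *)

Lemma first_failure (P : pred nat) n :
  P 0%N -> ~~ P n -> exists2 k, (k < n)%N & P k && ~~ P k.+1.
Proof.
move=> P0; elim: n => [|n IH nP]; first by rewrite P0.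
have [Pn|/IH[k kn Pk]] := boolP (P n); first by exists n; rewrite ?Pn.
by exists k => //; apply: ltnW.
Qed.

(** A vertex with mass would have gradient at most -2 from its self-deficit, below the bound -1.
    This starts the water level. *)
Lemma optimal_supp0 (R : realFieldType) (V : finType) (G : std_multigraph V)
    (S : {set V}) (r K : nat) (z : V -> R) (q : {ffun V -> 'I_K.+1}) :
  optimal G S r z q -> (forall u, z u <= 0) -> supp q = set0.
Proof.
move=> opt z0; apply/eqP/set0Pn=> -[u uq].
have := optimal_grad_ge opt uq; rewrite /grad (bigD1 u) //= deficitxx.
have : 0 <= \sum_(w | w != u) (deficit G u w)%:R * (q w)%:R :> R.
  by apply: sumr_ge0 => w _; rewrite mulr_ge0.
have : 1 <= (q u)%:R :> R by move: uq; rewrite inE -(ler_nat R).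
have := z0 u; lra.
Qed.

(** Raising the level by 1 adds four times the total mass to the energy; comparing each optimum with
    the other and adding the two inequalities gives the claim. *)
Lemma optimal_mass_mono (R : realFieldType) (V : finType) (G : std_multigraph V)
    (S : {set V}) (r K : nat) (y : V -> R) (h : R) (q q' : {ffun V -> 'I_K.+1}) :
  optimal G S r (fun u => h - y u) q ->
  optimal G S r (fun u => h + 1 - y u) q' ->
  \sum_u (q u)%:R <= \sum_u (q' u)%:R :> R.
Proof.
move=> [aq opt] [aq' opt'].
have shift (p : V -> R) : energy G (fun u => h + 1 - y u) p =
    energy G (fun u => h - y u) p + 4 * \sum_u p u.
  rewrite /energy.
  have -> : \sum_u (h + 1 - y u) * p u = \sum_u (h - y u) * p u + \sum_u p u.
    by rewrite -big_split /=; apply: eq_bigr => u _; ring.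
  ring.
have := opt _ aq'; have := opt' _ aq; rewrite !shift; lra.
Qed.

(* Motzkin-Straus symmetrization with the water level [h]: the vertices of
   cost below [h] receive masses, and [h] is raised until the support of an
   optimal mass distribution first contains an [r]-tile. Just before, no vertex
   can profitably receive mass, which bounds the total mass from below; just
   after, a saturated [r]-tile of the support is at least as profitable as the
   total mass. *)
Lemma cheap_tile (R : archiRealFieldType) (V : finType) (G : std_multigraph V)
    (S : {set V}) (r : nat) (y : V -> R) :
  (0 < r)%N -> (0 < #|S|)%N ->
  {in S, forall v, (r * set_deficit G S v <= 2 * #|S|)%N} ->
  exists I : {set V}, [/\ I \subset S, tile G I, #|I| = r &
    #|S|%:R * \sum_(i in I) y i <= r%:R * \sum_(u in S) y u + 2 * r%:R * #|S|%:R].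
Proof.
move=> r0 S0 dS; set s : R := #|S|%:R.
have s1 : 1 <= s by rewrite ler1n.
have r1 : 1 <= r%:R :> R by rewrite ler1n.
pose A := \sum_u `|y u|.
have yA u : `|y u| <= A by rewrite /A (bigD1 u) //= lerDl sumr_ge0.
have sumA (I : {set V}) : `|\sum_(i in I) y i| <= A.
  apply: le_trans (ler_norm_sum _ _ _) _.
  by rewrite /A [leRHS](bigID (mem I)) /= lerDl sumr_ge0.
have A0 : 0 <= A by apply: sumr_ge0.
(* The threshold beyond which the two mass bounds at level [K] contradict each other if there is no
   [r]-tile. It also serves as the mass cap. *)
pose K := Num.bound (r%:R * A + 2 * A + r%:R).
have KA : r%:R * A + 2 * A + r%:R < K%:R.
  by apply: archi_boundP; rewrite !addr_ge0 ?mulr_ge0.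
(* The shift by [A] makes every gain nonpositive at [k = 0] and at most [K] for all [k] up to
   [K]. *)
pose z (k : nat) u := k%:R - A - y u.
have zK k : (k <= K)%N -> forall u, z k u <= K%:R.
  rewrite -(ler_nat R) /z => kK u; have := yA u; rewrite ler_norml => /andP[+ _]; lra.
have /fin_all_exists[f fopt] (k : 'I_K.+1) : exists q : {ffun V -> 'I_K.+1},
  optimal G S r (z k) q by exact: optimal_exists.
pose g k := f (inord k).
have gopt k : (k <= K)%N -> optimal G S r (z k) (g k).
  by move=> kK; have := fopt (inord k); rewrite inordK.
have sumz k (I : {set V}) :
    \sum_(i in I) z k i = #|I|%:R * (k%:R - A) - \sum_(i in I) y i.
  by rewrite sumrB sumr_const mulr_natl.
pose P k := ~~ has_tile G (supp (g k)) r.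
have P0 : P 0%N.
  rewrite /P (optimal_supp0 (gopt 0%N _)) // => [|u].
    by apply/has_tileP=> -[I [+ _]]; rewrite subset0 => /eqP->; rewrite cards0; lia.
  by rewrite /z; have := yA u; rewrite ler_norml => /andP[+ _]; lra.
have mass k : (k <= K)%N -> P k ->
    2 * r%:R * (s * (k%:R - A) - \sum_(u in S) y u) - r%:R * s <=
    2 * s * \sum_u (g k u)%:R.
  move=> kK Pk; rewrite -sumz; apply: optimal_mass_ge (gopt k kK) Pk _ => //.
  by move=> u _; exact: zK.
have nPK : ~~ P K.
  apply/negP=> PK; have := mass K (leqnn K) PK.
  (* If level [K] had no [r]-tile, a largest tile of its support, of size [t < r], would bound the
     mass by about [t * (K - A)], while [mass] forces about [r * (K - A)]. *)
  have [t tr /andP[ht hnt]] := @first_failure (has_tile G (supp (g K))) r (has_tile0 _ _) PK.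
  have [I [sI tI cI sat]] := saturated_tile ht hnt.
  have := saturated_sum (gopt K (leqnn K)) sI sat; rewrite sumz cI.
  have := sumA I; have := sumA S; rewrite !ler_norml => /andP[_ yS] /andP[yI _] e1 e2.
  have tr' : t%:R + 1 <= r%:R :> R by rewrite natr1 ler_nat.
  have t0 : 0 <= t%:R :> R by [].
  set Q := \sum_u _ in e1 e2.
  have {e1} e1 : 2 * Q <= 2 * (t%:R * (K%:R - A)) + 2 * A + t%:R by lra.
  have e3 : 2 * s * Q <= s * (2 * (t%:R * (K%:R - A)) + 2 * A + t%:R).
    by rewrite [2 * s]mulrC -mulrA; apply: ler_wpM2l e1; lra.
  have e4 : t%:R * (K%:R - A) <= (r%:R - 1) * (K%:R - A).
    apply: ler_wpM2r; last lra.
    have : 0 <= r%:R * A by rewrite mulr_ge0.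
    lra.
  have e5 : 2 * r%:R * \sum_(u in S) y u <= s * (2 * r%:R * A).
    apply: le_trans (_ : 2 * r%:R * A <= _).
      by apply: ler_wpM2l; lra.
    by apply: ler_peMl => //; rewrite !mulr_ge0.
  have e6 : s * (2 * (t%:R * (K%:R - A)) + 2 * A + t%:R) <=
            s * (2 * ((r%:R - 1) * (K%:R - A)) + 2 * A + r%:R).
    by apply: ler_wpM2l; lra.
  have : 0 < s * (K%:R - (r%:R * A + 2 * A + r%:R)) by rewrite mulr_gt0 //; lra.
  lra.
have [k kK /andP[Pk]] := first_failure P0 nPK.
rewrite negbK => ht.
have hnt : ~~ has_tile G (supp (g k.+1)) r.+1 by case: (gopt k.+1 kK) => /andP[].
have [I [sI tI cI sat]] := saturated_tile ht hnt.
exists I; split=> //.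
  apply: subset_trans sI _; by case: (gopt k.+1 kK) => /andP[].
have := saturated_sum (gopt k.+1 kK) sI sat; rewrite sumz cI.
have := mass k (ltnW kK) Pk.
have : \sum_u (g k u)%:R <= \sum_u (g k.+1 u)%:R :> R.
  have o1 : optimal G S r (fun u => (k%:R - A) - y u) (g k) := gopt k (ltnW kK).
  have o2 : optimal G S r (fun u => (k%:R - A) + 1 - y u) (g k.+1).
    by have := gopt k.+1 kK; rewrite /z -natr1 [k%:R + 1 - A]addrAC.
  exact: optimal_mass_mono o1 o2.
(* Of the error [2 * r * #|S|], half comes from the unit step of the level and half from the
   integrality of the masses at the two levels. *)
rewrite -natr1; set Q := \sum_u _; set Q' := \sum_u _ => QQ' e1 e2.
have : s * (2 * Q - r%:R) <= s * (2 * (r%:R * (k%:R + 1 - A) - \sum_(i in I) y i)).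
  by apply: ler_wpM2l; lra.
lra.
Qed.

(** * The fourth-power potential and one removal step *)

(** The terms of order two and three in [t] are absorbed by completing squares. The relative growth
    [n^-1] is harmless over the at most [n / 2] removals. *)
Lemma pos_part_pow4 (R : realFieldType) (n x t : R) : 0 < n ->
  Num.max (x + t) 0 ^+ 4 <= (1 + n^-1) * Num.max x 0 ^+ 4 +
    4 * (Num.max x 0 ^+ 3 * t) + (16 * n + 3) * t ^+ 4.
Proof.
move=> n0; set b := Num.max x 0.
have b0 : 0 <= b by rewrite le_max lexx orbT.
apply: le_trans (_ : (b + t) ^+ 4 <= _).
  have -> : (b + t) ^+ 4 = `|b + t| ^+ 4.
    by rewrite -normrX ger0_norm // exprn_even_ge0.
  rewrite lerXn2r ?nnegrE // ?le_max ?lexx ?orbT // ge_max normr_ge0 andbT.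
  apply: le_trans (ler_norm _); rewrite lerD2r le_max lexx //.
have sq : 0 <= n^-1 * (b ^+ 2 - 4 * n * t ^+ 2) ^+ 2.
  by rewrite mulr_ge0 ?invr_ge0 ?sqr_ge0 // ltW.
have -> : (1 + n^-1) * b ^+ 4 + 4 * (b ^+ 3 * t) + (16 * n + 3) * t ^+ 4 =
    (b + t) ^+ 4 + n^-1 * (b ^+ 2 - 4 * n * t ^+ 2) ^+ 2
    + 2 * (t * (b - t)) ^+ 2.
  by field; rewrite gt_eqF.
have := sqr_ge0 (t * (b - t)); lra.
Qed.

Definition excess (R : realFieldType) (V : finType) (G : std_multigraph V)
    (c : R) (S : {set V}) (v : V) : R :=
  Num.max ((set_deficit G S v)%:R - c * #|S|%:R) 0.

Definition potential (R : realFieldType) (V : finType) (G : std_multigraph V)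
    (c : R) (S : {set V}) : R :=
  \sum_(v in S) excess G c S v ^+ 4.

Lemma excess_ge0 (R : realFieldType) (V : finType) (G : std_multigraph V)
    (c : R) (S : {set V}) (v : V) : 0 <= excess G c S v.
Proof. by rewrite le_max lexx orbT. Qed.

(* The tile is cheap for the costs that reward deficits to vertices of large
   excess, so that its removal does not increase the potential to first order. *)
Lemma potential_step (R : archiRealFieldType) (V : finType) (G : std_multigraph V)
    (S : {set V}) (r : nat) (c n : R) :
  (0 < r)%N -> (0 < #|S|)%N -> #|S|%:R <= n -> -2 <= c <= 2 ->
  {in S, forall v, (r * set_deficit G S v <= 2 * #|S|)%N} ->
  exists I : {set V}, [/\ I \subset S, tile G I, #|I| = r &
    potential G c (S :\: I) <= (1 + n^-1) * potential G c S +
      (8 * r%:R + n * ((16 * n + 3) * (4 * r%:R) ^+ 4))].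
Proof.
move=> r0 S0 Sn /andP[cl cu] dS.
set s : R := #|S|%:R.
have s1 : 1 <= s by rewrite ler1n.
have n0 : 0 < n by apply: lt_le_trans Sn; apply: lt_le_trans s1.
have rpos : 1 <= r%:R :> R by rewrite ler1n.
pose w v : R := excess G c S v ^+ 3.
have w0 v : 0 <= w v by rewrite exprn_ge0 // excess_ge0.
pose y i : R := - \sum_(v in S) w v * (deficit G v i)%:R.
have [I [sI tI cI cost]] := cheap_tile y r0 S0 dS.
exists I; split=> //.
have sumy (J : {set V}) :
    \sum_(i in J) y i = - \sum_(v in S) w v * (set_deficit G J v)%:R.
  rewrite sumrN exchange_big /=; congr (- _); apply: eq_bigr => v _.
  by rewrite -mulr_sumr /set_deficit natr_sum.
(* The change of the unclipped excess of [v] when [I] is removed. *)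
pose t v : R := c * r%:R - (set_deficit G I v)%:R.
have t4 v : t v ^+ 4 <= (4 * r%:R) ^+ 4.
  have -> : t v ^+ 4 = `|t v| ^+ 4.
    by rewrite -normrX ger0_norm // exprn_even_ge0.
  rewrite lerXn2r ?nnegrE //; first lra.
  have := set_deficit_le G I v; rewrite cI -(ler_nat R) natrM => dI.
  have dI0 : 0 <= (set_deficit G I v)%:R :> R by [].
  have c1 : -2 * r%:R <= c * r%:R by apply: ler_wpM2r => //; lra.
  have c2 : c * r%:R <= 2 * r%:R by apply: ler_wpM2r.
  by rewrite ler_norml /t; apply/andP; split; lra.
have drift : \sum_(v in S) w v * t v <= 2 * r%:R.
  (* The weights vanish where the deficit is below [c * s], so the weighted average deficit is at
     least [c * s]; the cheap tile takes a proportional share of it, up to [2 * r]. *)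
  have pos : 0 <= \sum_(v in S) w v * ((set_deficit G S v)%:R - c * s).
    apply: sumr_ge0 => v _; rewrite /w /excess -/s.
    have [h|h] := leP ((set_deficit G S v)%:R - c * s) 0.
      by rewrite expr0n mul0r.
    by rewrite mulr_ge0 ?exprn_ge0 // ltW.
  have e1 : \sum_(v in S) w v * ((set_deficit G S v)%:R - c * s) =
     \sum_(v in S) w v * (set_deficit G S v)%:R - c * s * \sum_(v in S) w v.
    rewrite mulr_sumr -sumrB; apply: eq_bigr => v _; ring.
  have e2 : \sum_(v in S) w v * t v =
     c * r%:R * (\sum_(v in S) w v) - \sum_(v in S) w v * (set_deficit G I v)%:R.
    rewrite mulr_sumr -sumrB; apply: eq_bigr => v _; rewrite /t; ring.
  rewrite e1 in pos; rewrite e2.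
  move: cost; rewrite !sumy -/s.
  set DI := \sum_(v in S) _ * _%:R; set DS := \sum_(v in S) _ * _%:R in pos *.
  set W := \sum_(v in S) _ in pos * => cost.
  have p2 : 0 <= r%:R * (DS - c * s * W) by rewrite mulr_ge0.
  rewrite -(ler_pM2l (lt_le_trans ltr01 s1)); lra.
apply: le_trans (_ : \sum_(v in S) ((1 + n^-1) * excess G c S v ^+ 4 +
    4 * (w v * t v) + (16 * n + 3) * (4 * r%:R) ^+ 4) <= _); last first.
  rewrite !big_split /= sumr_const -[_ *+ #|S|]mulr_natl -/s -!mulr_sumr -addrA lerD2l.
  apply: lerD; first by lra.
  by apply: ler_wpM2r => //; rewrite mulr_ge0 ?exprn_ge0 //; lra.
have bound v : excess G c (S :\: I) v ^+ 4 <= (1 + n^-1) * excess G c S v ^+ 4 +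
    4 * (w v * t v) + (16 * n + 3) * (4 * r%:R) ^+ 4.
  have -> : excess G c (S :\: I) v =
      Num.max ((set_deficit G S v)%:R - c * s + t v) 0.
    rewrite /excess /t; congr (Num.max _ _).
    rewrite (set_deficitD G v sI) natrD /s -(cardsID I S) (setIidPr sI) cI natrD; ring.
  apply: le_trans (pos_part_pow4 _ _ n0) _; rewrite -/(excess G c S v) lerD2l.
  by apply: ler_wpM2l => //; lra.
rewrite /potential.
apply: le_trans (_ : \sum_(v in S) excess G c (S :\: I) v ^+ 4 <= _).
  rewrite [leRHS](big_setID I) /= lerDr; apply: sumr_ge0 => v _.
  by rewrite exprn_ge0 // excess_ge0.
by apply: ler_sum => v _.
Qed.

(** * From degrees to deficits, and from tiles to members of the family *)

Lemma degree_deficit (V : finType) (G : std_multigraph V) (x : V) :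
  (set_deficit G [set: V] x + degree G x = 2 * #|V|)%N.
Proof.
rewrite /set_deficit /degree; under eq_bigl do rewrite inE.
rewrite -big_split /= mulnC -sum_nat_const.
by apply: eq_bigr => y _; rewrite subnK // mu_le2.
Qed.

Lemma min_degree_le (V : finType) (G : std_multigraph V) (x : V) :
  (min_degree G <= degree G x)%N.
Proof.
rewrite /min_degree; have := mem_index_enum x.
elim: (index_enum V) => // v l IH; rewrite inE big_cons geq_min.
by case/orP=> [/eqP->|/IH->]; rewrite ?leqnn ?orbT.
Qed.

Lemma deficit2_tile (V : finType) (G : std_multigraph V) (I : {set V}) a b c :
  tile G I -> a \in I -> b \in I -> c \in I -> a != b -> a != c -> b != c ->
  (deficit G a b + deficit G a c <= 1)%N.
Proof.
move=> /tileP tI aI bI cI ab ac bc; have := tI a aI.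
rewrite (set_deficitD1 G a aI) deficitxx.
have bI' : b \in I :\ a by rewrite !inE eq_sym ab.
have cI' : c \in I :\ a :\ b by rewrite !inE eq_sym bc eq_sym ac.
rewrite (set_deficitD1 G a bI') (set_deficitD1 G a cI'); lia.
Qed.

Lemma deficit_tile (V : finType) (G : std_multigraph V) (I : {set V}) a b :
  tile G I -> a \in I -> b \in I -> a != b -> (deficit G a b <= 1)%N.
Proof.
move=> /tileP tI aI bI ab; have := tI a aI; rewrite (set_deficitD1 G a aI) deficitxx.
have bI' : b \in I :\ a by rewrite !inE eq_sym ab.
rewrite (set_deficitD1 G a bI'); lia.
Qed.

(** The self-deficit 2 leaves each vertex a budget of 1: no pair is missing and no vertex lies on
    two light edges, so the light pairs form a matching. [F] carries all multiplicities induced on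
    [I]. *)
Lemma tile_Kbar (V : finType) (G : std_multigraph V) (I : {set V}) (r : nat) :
  tile G I -> #|I| = r ->
  exists F : submultigraph G, vset F = I /\
    exists2 H : std_multigraph 'I_r, Kbar H & sub_iso F H.
Proof.
move=> tI cI.
pose m x y := if (x \in I) && (y \in I) then G x y else 0%N.
have msym x y : m x y = m y x by rewrite /m andbC mu_sym.
have mle x y : (m x y <= G x y)%N by rewrite /m; case: ifP.
have mout x y : x \notin I -> m x y = 0%N by rewrite /m => /negPf->.
exists (Submultigraph msym mle mout); split=> //.
pose phi (i : 'I_r) : V := enum_val (cast_ord (esym cI) i).
have phiI i : phi i \in I by exact: enum_valP.
have phi_inj : injective phi by move=> i j /enum_val_inj/cast_ord_inj.
pose h i j := G (phi i) (phi j).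
have hsym i j : h i j = h j i by exact: mu_sym.
have h0 i : h i i = 0%N by exact: mu_loopless.
have h2 i j : (h i j <= 2)%N by exact: mu_le2.
exists (StdMultigraph hsym h0 h2); last first.
  exists phi; split=> //=; last by move=> i j; rewrite /m !phiI.
  apply/eqP; rewrite eqEcard card_imset // cardsT card_ord cI leqnn andbT.
  by apply/subsetP=> _ /imsetP[i _ ->].
pose light i j := h i j == 1%N.
pose M := [set [set p.1; p.2] | p : 'I_r * 'I_r & light p.1 p.2].
have lightC i j : light i j = light j i by rewrite /light hsym.
have lightN i j : light i j -> i != j by apply: contraTneq => ->; rewrite /light h0.
have light_uniq a b c : light a b -> light a c -> b = c.
  move=> lab lac; apply/eqP/negPn/negP=> bc.
  have := deficit2_tile tI (phiI a) (phiI b) (phiI c).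
  rewrite !(inj_eq phi_inj) lightN // lightN // bc => /(_ isT isT isT).
  by rewrite /deficit -!/(h _ _) (eqP lab) (eqP lac).
have edge a e : e \in M -> a \in e -> exists2 b, light a b & e = [set a; b].
  move=> /imsetP[[i j] /= ]; rewrite inE /= => lij -> /set2P[->|->].
    by exists j.
  by exists i; [rewrite lightC | rewrite setUC].
have inM i j : ([set i; j] \in M) = light i j.
  apply/idP/idP=> [eM|lij]; last by apply/imsetP; exists (i, j); rewrite ?inE.
  have [b lib E] := edge i _ eM (set21 _ _).
  have [ij|ij] := eqVneq i j.
    have : b \in [set i; j] by rewrite E set22.
    by rewrite -ij !inE orbb => /eqP bi; rewrite bi in lib; case/eqP: (lightN _ _ lib).
  have : j \in [set i; b] by rewrite -E set22.
  by rewrite !inE eq_sym (negPf ij) => /eqP->.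
exists M; last first.
  move=> i j ij; rewrite inM /light /=.
  have := deficit_tile tI (phiI i) (phiI j); rewrite (inj_eq phi_inj) => /(_ ij).
  have := h2 i j; rewrite /deficit -/(h i j); case: eqP; lia.
split=> [_ /imsetP[[i j] + ->]|]; first by rewrite inE /= => /lightN; rewrite cards2 => ->.
apply/trivIsetP=> e e' eM eM'; apply: contra_neqT => /pred0Pn[a /andP[/= ae ae']].
have [b lab ->] := edge _ _ eM ae; have [b' lab' ->] := edge _ _ eM' ae'.
by rewrite (light_uniq _ _ _ lab lab').
Qed.

(** * Sequences of disjoint tiles *)

(** Indexing by [nat], with only the first [k] values constrained, keeps the type fixed when a tile
    is appended. *)
Definition tiles (V : finType) (G : std_multigraph V) (r k : nat)
    (T : nat -> {set V}) : Prop :=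
  (forall i, (i < k)%N -> tile G (T i) /\ #|T i| = r) /\
  (forall i j, (i < j < k)%N -> [disjoint T i & T j]).

Lemma tiles_Kbar_tiling (V : finType) (G : std_multigraph V) (r k : nat)
    (T : nat -> {set V}) :
  tiles G r k T ->
  exists2 F : 'I_k -> submultigraph G, Kbar_tiling r F &
    covered F = \bigcup_(i < k) T i.
Proof.
move=> [tT dT].
have /fin_all_exists[F FT] (i : 'I_k) : exists F : submultigraph G, vset F = T i /\
    exists2 H : std_multigraph 'I_r, Kbar H & sub_iso F H.
  by have [t c] := tT i (ltn_ord i); exact: tile_Kbar.
exists F; last by apply: eq_bigr => i _; case: (FT i).
split=> [i j ij|i]; last by case: (FT i).
have [-> _] := FT i; have [-> _] := FT j.
case: (ltngtP i j) => [lt|lt|/val_inj eq]; last by rewrite eq eqxx in ij.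
  by apply: dT; rewrite lt ltn_ord.
by rewrite disjoint_sym; apply: dT; rewrite lt ltn_ord.
Qed.

Lemma tiles_extend (V : finType) (G : std_multigraph V) (r k : nat)
    (T : nat -> {set V}) (I : {set V}) :
  tiles G r k T -> tile G I -> #|I| = r -> I \subset ~: (\bigcup_(i < k) T i) ->
  exists2 T' : nat -> {set V}, tiles G r k.+1 T' &
    ~: (\bigcup_(i < k.+1) T' i) = (~: (\bigcup_(i < k) T i)) :\: I.
Proof.
move=> [tT dT] tI cI sI; pose T' i := if i == k then I else T i.
have T'E i : (i < k)%N -> T' i = T i by rewrite /T'; case: ltngtP.
have T'k : T' k = I by rewrite /T' eqxx.
exists T'; last first.
  rewrite big_ord_recr /= T'k setCU setDE; congr (~: _ :&: _).
  by apply: eq_bigr => i _; rewrite T'E.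
split=> [i|i j]; rewrite ltnS.
  by rewrite leq_eqVlt => /predU1P[->|ik]; rewrite ?T'k ?T'E //; apply: tT.
case/andP=> ij; rewrite leq_eqVlt => /predU1P[jk|jk].
  rewrite jk in ij *; rewrite T'k T'E // disjoint_sym disjoints_subset.
  apply: subset_trans sI _; rewrite setCS.
  exact: (bigcup_sup (Ordinal ij)).
by rewrite !T'E ?dT ?ij ?(ltn_trans ij jk).
Qed.

(** * Control of the potential along the greedy removal *)

(** The coefficients add up to 8 + 4096 + 768 = 4872, rounded up to 5000. *)
Lemma step_cost (R : realFieldType) (r n : R) : 1 <= r -> 1 <= n ->
  8 * r + n * ((16 * n + 3) * (4 * r) ^+ 4) <= 5000 * r ^+ 4 * n ^+ 2.
Proof.
move=> r1 n1; have r0 : 0 <= r by lra.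
have n2 : n <= n ^+ 2 by rewrite expr2 ler_peMr //; lra.
have r4 : r <= r ^+ 4 by rewrite [leRHS]exprS ler_peMr // exprn_ege1.
have r40 : 0 <= r ^+ 4 by rewrite exprn_ge0.
have h1 : r ^+ 4 <= r ^+ 4 * n ^+ 2 by rewrite ler_peMr // exprn_ege1.
have h2 : r ^+ 4 * n <= r ^+ 4 * n ^+ 2 by rewrite ler_wpM2l.
have -> : n * ((16 * n + 3) * (4 * r) ^+ 4) =
  4096 * (r ^+ 4 * n ^+ 2) + 768 * (r ^+ 4 * n) by ring.
rewrite -mulrA; move: (r ^+ 4) (r ^+ 4 * n ^+ 2) (r ^+ 4 * n) r4 h1 h2 => x y z.
lra.
Qed.

(** While [2 * k <= n], the relative growth contributes at most [n^-1 * (2 * A * k) <= A], so each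
    step adds at most [2 * A]. *)
Lemma growth_step (R : realFieldType) (A n k p p' : R) : 0 <= A -> 0 < n ->
  2 * k <= n -> p <= 2 * A * k -> p' <= (1 + n^-1) * p + A -> p' <= 2 * A * (k + 1).
Proof.
move=> A0 n0 kn pk; move/le_trans; apply.
have nV : 0 <= n^-1 by rewrite invr_ge0 ltW.
have h3 : (1 + n^-1) * p <= (1 + n^-1) * (2 * A * k).
  by apply: ler_wpM2l => //; rewrite addr_ge0.
have h4 : n^-1 * A * (2 * k) <= n^-1 * A * n by apply: ler_wpM2l => //; rewrite mulr_ge0.
have h5 : n^-1 * A * n = A by rewrite mulrAC mulVf ?mul1r // gt_eqF.
lra.
Qed.

(** A larger deficit would mean an excess of at least [2 * eta ^+ 2 * n], whose fourth power
    [16 * eta ^+ 8 * n ^+ 4] already exceeds the potential. *)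
Lemma excess_small (R : realFieldType) (V : finType) (G : std_multigraph V)
    (c eta n C : R) (S : {set V}) (v : V) :
  0 < eta -> 0 < n -> C < 16 * eta ^+ 8 * n -> potential G c S <= C * n ^+ 3 ->
  eta * n < #|S|%:R -> v \in S ->
  (set_deficit G S v)%:R <= (c + 2 * eta) * #|S|%:R.
Proof.
move=> eta0 n0 Cn pC large vS; rewrite mulrDl -lerBlDl leNgt; apply/negP=> H.
pose b := 2 * eta * (eta * n).
have eta2 : 0 <= 2 * eta by rewrite mulr_ge0 // ltW.
have b0 : 0 <= b by rewrite mulr_ge0 // mulr_ge0 // ltW.
have bE : b <= excess G c S v.
  rewrite le_max; apply/orP; left; apply/ltW/(le_lt_trans _ H).
  by rewrite ler_wpM2l // ltW.
have bp : b ^+ 4 <= potential G c S.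
  apply: le_trans (_ : excess G c S v ^+ 4 <= _).
    by rewrite lerXn2r ?nnegrE ?excess_ge0.
  rewrite /potential (bigD1 v) //= lerDl; apply: sumr_ge0 => u _.
  by rewrite exprn_ge0 // excess_ge0.
have : C * n ^+ 3 < 16 * eta ^+ 8 * n * n ^+ 3 by rewrite ltr_pM2r // exprn_gt0.
have -> : 16 * eta ^+ 8 * n * n ^+ 3 = b ^+ 4 by rewrite /b; ring.
by rewrite ltNge (le_trans bp pC).
Qed.

(** Either the removal has stopped with few vertices left, or [k] tiles are out and the potential is
    still linear in [k]. For the target [2 / r - 2 * eta] the initial potential is 0, and the slack
    [2 * eta] restores the ratio [2 / r] that the next step needs. *)
Lemma many_tiles (R : archiRealFieldType) (r : nat) (eta : R)
    (V : finType) (G : std_multigraph V) (k : nat) :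
  (2 <= r)%N -> 0 < eta -> eta <= 1 -> (0 < #|V|)%N ->
  5000 * r%:R ^+ 4 < 16 * eta ^+ 8 * #|V|%:R ->
  (forall v, (set_deficit G [set: V] v)%:R <= (2 / r%:R - 2 * eta) * #|V|%:R) ->
  (exists k', exists2 T, tiles G r k' T &
     #|~: (\bigcup_(i < k') T i)|%:R <= eta * #|V|%:R) \/
  (exists T, [/\ tiles G r k T, (#|~: (\bigcup_(i < k) T i)| + r * k = #|V|)%N &
     potential G (2 / r%:R - 2 * eta) (~: (\bigcup_(i < k) T i)) <=
       2 * (5000 * r%:R ^+ 4 * #|V|%:R ^+ 2) * k%:R]).
Proof.
move=> r2 eta0 eta1 V0 Vbig dV.
have r1 : 2 <= r%:R :> R by rewrite ler_nat.
have cb : -2 <= 2 / r%:R - 2 * eta <= 2.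
  have rV : 0 <= (r%:R^-1 : R) <= 1.
    by apply/andP; split; [rewrite invr_ge0 | rewrite invf_le1; lra].
  by clear Vbig dV; apply/andP; split; lra.
have n1 : 1 <= #|V|%:R :> R by rewrite ler1n.
move: cb dV Vbig n1; set n : R := #|V|%:R; set c : R := _ - _ => cb dV Vbig n1.
have n0 : 0 < n := lt_le_trans ltr01 n1.
have A0 : 0 <= 5000 * r%:R ^+ 4 * n ^+ 2 by rewrite !mulr_ge0 ?exprn_ge0.
elim: k => [|k [IH|[T [tT cT pT]]]]; last 1 first.
- set S := ~: _ in cT pT.
  have [small|large] := lerP #|S|%:R (eta * n); first by left; exists k, T.
  have Sn : #|S|%:R <= n by rewrite ler_nat max_card.
  have S0 : (0 < #|S|)%N.
    by rewrite -(ltr_nat R); apply: le_lt_trans large; rewrite mulr_ge0 // ltW.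
  (* Tiles have at least two vertices, so at most [n / 2] of them have been removed. *)
  have kn : 2 * k%:R <= n.
    rewrite -natrM ler_nat -cT; apply: leq_trans (leq_addl _ _).
    by rewrite leq_mul2r r2 orbT.
  have pn : potential G c S <= 5000 * r%:R ^+ 4 * n ^+ 3.
    apply: le_trans pT _.
    rewrite [n ^+ 3]exprSr [leRHS]mulrA.
    by apply: le_trans (ler_wpM2l A0 kn); rewrite [leRHS]mulrCA [leRHS]mulrA.
  have dS : {in S, forall v, (r * set_deficit G S v <= 2 * #|S|)%N}.
    move=> v vS; rewrite -(ler_nat R) !natrM.
    have := excess_small eta0 n0 Vbig pn large vS; rewrite subrK.
    by rewrite mulrAC ler_pdivlMr ?(lt_le_trans _ r1) // mulrC.
  have [I [sI tI cI pI]] := potential_step (ltnW r2) S0 Sn cb dS.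
  right; have [T' tT' ST'] := tiles_extend tT tI cI sI.
  exists T'; rewrite ST'; split=> //.
    by rewrite mulnS -cT -(cardsID I S) (setIidPr sI) cI addnCA addnA.
  rewrite -[k.+1%:R]natr1; apply: (growth_step A0 n0 kn pT); apply: le_trans pI _.
  by rewrite lerD2l; apply: step_cost => //; rewrite ler1n ltnW.
- right; exists (fun=> set0); rewrite big_ord0 setC0 cardsT muln0 addn0; split=> //.
    by split=> // i j; rewrite ltn0 andbF.
  rewrite mulr0 /potential big1 // => v _; rewrite /excess cardsT.
  have /max_idPr -> : (set_deficit G [set: V] v)%:R - c * #|V|%:R <= 0.
    by rewrite subr_le0 dV.
  by rewrite expr0n.
- by left.
Qed.

Theorem theorem6p1 (R : realType) (r : nat) (hr : (2 <= r)%N) :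
  exists2 eta0 : R, 0 < eta0 &
  forall eta : R, 0 < eta -> eta <= eta0 ->
  exists n0 : nat, forall n : nat, (n0 <= n)%N ->
  forall (V : finType) (G : std_multigraph V), #|V| = n ->
    2 * (1 - r%:R^-1 + eta) * n%:R <= (min_degree G)%:R ->
    exists k : nat, exists2 T : 'I_k -> submultigraph G, Kbar_tiling r T &
      #|~: covered T|%:R <= eta * n%:R.
Proof.
exists 1 => // eta eta0 eta1.
have e0 : 0 < 16 * eta ^+ 8 by rewrite mulr_gt0 // exprn_gt0.
(* This makes [n] large enough for the comparison in [excess_small]. *)
exists (Num.bound (5000 * r%:R ^+ 4 / (16 * eta ^+ 8))).+1 => n nbig V G Vn dG.
have n0 : (0 < #|V|)%N by rewrite Vn; apply: leq_trans nbig.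
have Vbig : 5000 * r%:R ^+ 4 < 16 * eta ^+ 8 * #|V|%:R.
  rewrite [ltRHS]mulrC -ltr_pdivrMr // Vn; apply: lt_le_trans (archi_boundP _) _.
    by rewrite divr_ge0 ?mulr_ge0 ?exprn_ge0 // ltW.
  by rewrite ler_nat ltnW.
have dV v : (set_deficit G [set: V] v)%:R <= (2 / r%:R - 2 * eta) * #|V|%:R.
  have := degree_deficit G v => /(congr1 (fun k => k%:R : R)); rewrite natrD natrM.
  have := min_degree_le G v; rewrite -(ler_nat R) Vn; lra.
(* [n.+1] disjoint tiles do not fit into [n] vertices, so the removal stopped early. *)
have [[k [T tT small]]|[T [_ full _]]] := many_tiles n.+1 hr eta0 eta1 n0 Vbig dV.
  have [F KF cF] := tiles_Kbar_tiling tT; exists k, F => //.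
  by rewrite cF -Vn.
by move: full hr; rewrite Vn; nia.
Qed.
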